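(* Let $\{(x^k,\epsilon^k)\}$ be the sequence generated by Algorithm IReNA (described in the context, run with tolerance $\tau=0$) under the standing assumptions in the context, and suppose $x^k\to x^*\in\chi^\infty$, where $\chi^\infty$ is the set of stationary (cluster) points of $\{x^k\}$. Write $\mathcal{I}^*=\mathcal{I}(x^* )$. Suppose there is $M>0$ with $\|\nabla^2_{\mathcal{I}^*\mathcal{I}^*}F(x^* )^{-1}\|\le M$, and that for all sufficiently large $k$: (i) the exact Hessian $H^k=\nabla^2_{\mathcal{I}^k\mathcal{I}^k}F(x^k;\epsilon^k)$ is used in $m_k(d)$ and $\mathcal{W}_k\equiv\mathcal{I}^k=\mathcal{I}(x^* )$; (ii) the reduced-space QP subproblem is solved exactly, i.e. $\tilde d^k=-(H^k)^{-1}g^k$; (iii) the unit stepsize $\tilde\alpha_k\equiv1$ is accepted. Then there exist $\check k\in\mathbb{N}$ and $\rho>0$ such that, whenever $k\ge\check k$ and $x^k\in\mathcal{B}(x^*,\rho):=\{y:\|y-x^*\|\le\rho\}$, $$\|x^{k+1}-x^*\|\le\frac{3ML_H}{2}\|x^k-x^*\|^2+\mathcal{O}(\|\epsilon^k_{\mathcal{I}^*}\|),$$ where $\nabla^2_{\mathcal{I}^*\mathcal{I}^*}F(x)$ is (assumed) locally Lipschitz continuous with constant $L_H>0$ on $\mathcal{B}(x^*,\rho)$ (in the reduced subspace $\{x:x_{\mathcal{I}_0(x^* )}=0\}$).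
   Context: **Problem.** $[n]=\{1,\dots,n\}$, $\|\cdot\|$ is the $\ell_2$ norm. $\lambda>0$; $f:\mathbb{R}^n\to\mathbb{R}$ is twice continuously differentiable (possibly nonconvex); $r:\mathbb{R}\to[0,\infty)$ is $C^2$ on $\mathbb{R}\setminus\{0\}$ with $r(0)=0$, $r'(t)>0$ and $r''(t)\le 0$ for $t>0$; $r'(0^+)=\lim_{t\downarrow0}r'(t)\in(0,+\infty]$. The problem is to minimize $F(x):=f(x)+\lambda\sum_{i=1}^n r(|x_i|)$. For $\epsilon\in\mathbb{R}^n$, $\epsilon\ge 0$, put $F(x;\epsilon):=f(x)+\lambda\sum_{i=1}^n r(|x_i|+\epsilon_i)$ (so $F(x)=F(x;0)$), and weights $\omega_i=\omega(x_i,\epsilon_i):=\lambda r'(|x_i|+\epsilon_i)$; $\omega_i^k:=\omega(x_i^k,\epsilon_i^k)$. A point $x^*$ is a (first-order) stationary point if $0\in\nabla_if(x^* )+\lambda\,\partial r(|x_i^*|)$ for all $i\in[n]$, where $\partial r(|x_i|)$ denotes the subdifferential of $t\mapsto r(|t|)$ at $t=x_i$: it is $\{r'(|x_i|)\,\mathrm{sgn}(x_i)\}$ if $x_i\ne0$, and $[-r'(0^+),r'(0^+)]$ (equal to $\mathbb{R}$ if $r'(0^+)=+\infty$) if $x_i=0$. **Notation.** $\mathcal{I}(x)=\{i: x_i\neq0\}$, $\mathcal{I}_0(x)=\{i:x_i=0\}$, $\mathcal{I}_+(x)=\{i:x_i>0\}$, $\mathcal{I}_-(x)=\{i:x_i<0\}$;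 $\mathcal{I}^k=\mathcal{I}(x^k)$, $\mathcal{I}_0^k=\mathcal{I}_0(x^k)$. $\mathrm{sgn}$ acts componentwise with $\mathrm{sgn}(0)=0$. For $\mathcal{S}\subseteq[n]$, $x_{\mathcal{S}}$ is the subvector indexed by $\mathcal{S}$. For $\mathcal{S}\subseteq\mathcal{I}(x)$, $\nabla_{\mathcal{S}}F(x;\epsilon)$ and $\nabla^2_{\mathcal{S}\mathcal{S}}F(x;\epsilon)$ are the gradient and Hessian with respect to $x_{\mathcal{S}}$; thus $\nabla_iF(x;\epsilon)=\nabla_if(x)+\omega_i\,\mathrm{sgn}(x_i)$ for $i\in\mathcal{I}(x)$. Soft-thresholding: $[\mathbb{S}_\omega(v)]_i=\mathrm{sgn}(v_i)\max(|v_i|-\omega_i,0)$. Orthant projection: $[\mathbb{P}(y;x)]_i=\mathrm{sgn}(x_i)\max\{0,\mathrm{sgn}(x_i)y_i\}$. **Residuals.** $[\Psi(x;\epsilon)]_i=\nabla_if(x)+\omega_i$ if $i\in\mathcal{I}_0(x)$ and $\nabla_if(x)+\omega_i<0$; $=\nabla_if(x)-\omega_i$ if $i\in\mathcal{I}_0(x)$ and $\nabla_if(x)-\omega_i>0$; $=0$ otherwise. $[\Phi(x;\epsilon)]_i=0$ if $i\in\mathcal{I}_0(x)$; $=\min\{\nabla_if(x)+\omega_i,\max\{x_i,\nabla_if(x)-\omega_i\}\}$ if $i\in\mathcal{I}_+(x)$ and $\nabla_if(x)+\omega_i>0$; $=\max\{\nabla_if(x)-\omega_i,\min\{x_i,\nabla_if(x)+\omega_i\}\}$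 if $i\in\mathcal{I}_-(x)$ and $\nabla_if(x)-\omega_i<0$; $=\nabla_if(x)+\omega_i\,\mathrm{sgn}(x_i)$ otherwise. Write $\Psi^k=\Psi(x^k;\epsilon^k)$, $\Phi^k=\Phi(x^k;\epsilon^k)$. Also $G_k(x):=f(x)+\sum_{i=1}^n\omega_i^k|x_i|$. **Algorithm IReNA.** Inputs: $x^0\in\mathbb{R}^n$, $\epsilon^0\in\mathbb{R}^n_{++}$, $\eta_\Phi,\eta_\Psi\in(0,1]$, $\gamma_\epsilon,\gamma_\beta,\gamma_\alpha\in(0,1)$, $\eta,\xi_\beta,\xi_\alpha,\bar\beta,\nu\in(0,\infty)$, regularization parameters $\zeta_k\in(0,\infty)$, tolerance $\tau\geq 0$. For $k=0,1,2,\dots$: 1. Stop if $\max\{\|\Psi^k\|,\|\Phi^k\|\}\le\tau$ and $\epsilon_i^k\le\tau$ for all $i\in\mathcal{I}^k$. 2. (Subspace) Choose $\mathcal{W}_k$: if $\|\Psi^k\|\ge\eta\|\Phi^k\|$, then $\mathcal{W}_k\subseteq\{i:[\Psi^k]_i\ne0\}$ with $\|[\Psi^k]_{\mathcal{W}_k}\|\ge\eta_\Psi\|\Psi^k\|$; otherwise $\mathcal{W}_k\subseteq\{i:[\Phi^k]_i\ne0\}$ with $\|[\Phi^k]_{\mathcal{W}_k}\|\ge\eta_\Phi\|\Phi^k\|$. 3. (IST step) For $j=0,1,\dots$ with $\beta_j=\bar\beta\gamma_\beta^j$, let $y^j$ agree with $x^k$ off $\mathcal{W}_k$ and $y^j_{\mathcal{W}_k}=[\mathbb{S}_{\beta_j\omega^k}(x^k-\beta_j\nabla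 f(x^k))]_{\mathcal{W}_k}$; stop at the first $j$ with $G_k(y^j)\le G_k(x^k)-\frac{\xi_\beta}{2}\|y^j-x^k\|^2$, and set $\hat x^k=y^j$, $\hat\beta_k=\beta_j$, $\hat\Delta^k_{\rm IST}=G_k(x^k)-G_k(y^j)$. 4. If $\mathrm{sgn}(\hat x^k)\neq\mathrm{sgn}(x^k)$, set $x^{k+1}=\hat x^k$. If $\mathrm{sgn}(\hat x^k)=\mathrm{sgn}(x^k)$: (a) (QP subproblem) with $g^k=\nabla_{\mathcal{W}_k}F(x^k;\epsilon^k)$, $H^k=\nabla^2_{\mathcal{W}_k\mathcal{W}_k}F(x^k;\epsilon^k)+\zeta_kI\succ0$, $m_k(d)=\langle g^k,d\rangle+\frac12\langle d,H^kd\rangle$ and $d_R^k=-\frac{\|g^k\|^2}{\langle g^k,H^kg^k\rangle}g^k$, find $\tilde d^k\in\mathbb{R}^{|\mathcal{W}_k|}$ with $\langle g^k,\tilde d^k\rangle\le\langle g^k,d_R^k\rangle$ and $m_k(\tilde d^k)\le m_k(0)$ (extended by zero off $\mathcal{W}_k$); (b) (Projected line search) start with $\alpha_0=1$ and for $j=0,1,\dots$ let $y^j=\mathbb{P}(x^k+\alpha_j\tilde d^k;x^k)$; the first time that $\mathrm{sgn}(y^j)=\mathrm{sgn}(x^k)$, reset $\alpha_j=\min\{1,\alpha_B\}$ with $\alpha_B=\sup\{\alpha>0:\mathrm{sgn}(x^k+\alpha\tilde d^k)=\mathrm{sgn}(x^k)\}$ and recompute $y^j=\mathbb{P}(x^k+\alpha_j\tilde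 d^k;x^k)$; stop if $F(y^j;\epsilon^k)\le F(x^k;\epsilon^k)-\frac{\xi_\alpha}{2}\|y^j-x^k\|^2$, else $\alpha_{j+1}=\gamma_\alpha\alpha_j$. On stopping set $\tilde x^k=y^j$, $\tilde\alpha_k=\alpha_j$, $\tilde\Delta^k_{\rm QP}=F(x^k;\epsilon^k)-F(y^j;\epsilon^k)$; (c) if $\mathrm{sgn}(\tilde x^k)\ne\mathrm{sgn}(x^k)$ and $\tilde\Delta^k_{\rm QP}<\nu\hat\Delta^k_{\rm IST}$, set $x^{k+1}=\hat x^k$; otherwise set $x^{k+1}=\tilde x^k$. 5. Choose $\epsilon_i^{k+1}\in(0,\gamma_\epsilon\epsilon_i^k)$ for $i\in\mathcal{I}^{k+1}$ and set $\epsilon_i^{k+1}=\epsilon_i^k$ for $i\in\mathcal{I}_0^{k+1}$; update $\omega_i^{k+1}=\lambda r'(|x_i^{k+1}|+\epsilon_i^{k+1})$. In the claim, hypotheses (i)–(ii) replace the choices of $H^k$ and $\tilde d^k$ in step 4(a) for all large $k$. **Standing assumptions.** (1) $\tau=0$, and the level set $\mathrm{Lev}_F:=\{x:F(x)\le F(x^0;\epsilon^0)\}$ is contained in a bounded ball $\{x:\|x\|\le R\}$, so that $F$ is bounded below and $\nabla f$ is Lipschitz on $\mathrm{Lev}_F$ with constant $L_f>0$. (2) (Nondegeneracy) At any first-order stationary point $x^*$ of the problem, $\nabla_if(x^* )\in(-\lambda r'(0^+),\lambda r'(0^+))$ for all $i\in\mathcal{I}_0(x^* )$. Under (1)–(2),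 for all sufficiently large $k$ the iterate is $x^{k+1}=\tilde x^k$ with $\mathrm{sgn}(x^{k+1})=\mathrm{sgn}(x^k)$.
   Formalization: The formal theorem additionally assumes that r'' is Lipschitz near |x*_i| for each i in I*; for r merely C^2, Lipschitz continuity of the reduced Hessian of F(x) alone does not make the effect of epsilon^k on the Newton step O(||epsilon^k||), and the bound can fail. *)

(* Defs.v *)
From HB Require Import structures.
From mathcomp Require Import all_boot all_order all_algebra.
From mathcomp Require Import all_classical all_reals all_analysis.

Set Implicit Arguments.
Unset Strict Implicit.
Unset Printing Implicit Defensive.

Import Order.TTheory GRing.Theory Num.Theory.
Import numFieldNormedType.Exports.

Local Open Scope classical_set_scope.
Local Open Scope ring_scope.

(* R^n is 'cV[R]_n.  The library norm on matrices is the
   max-norm; it induces the usual topology, but all norms below are the l2 norm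
   and the operator norm induced by it. *)

Definition dot (R : realType) (n : nat) (u v : 'cV[R]_n) : R :=
  \sum_i u i 0 * v i 0.

Definition norm2 (R : realType) (n : nat) (u : 'cV[R]_n) : R :=
  Num.sqrt (dot u u).

Definition opnorm (R : realType) (m n : nat) (A : 'M[R]_(m, n)) : R :=
  sup [set norm2 (A *m v) | v in [set v : 'cV[R]_n | norm2 v <= 1]].

Definition posdef (R : realType) (n : nat) (A : 'M[R]_n) : Prop :=
  A^T = A /\ forall v : 'cV[R]_n, v != 0 -> 0 < dot v (A *m v).

Definition sgnv (R : realType) (n : nat) (x : 'cV[R]_n) : 'cV[R]_n :=
  map_mx Num.sg x.

Definition supp (R : realType) (n : nat) (x : 'cV[R]_n) : {set 'I_n} :=
  [set i | x i 0 != 0]%SET.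

(* Vectors and matrices indexed by S have dimension #|S|; the a-th coordinate
   corresponds to the a-th element [enum_val a] of S. *)
Definition subv (R : realType) (n : nat) (S : {set 'I_n}) (x : 'cV[R]_n)
  : 'cV[R]_#|S| := \col_a x (enum_val a) 0.

Definition ext0 (R : realType) (n : nat) (S : {set 'I_n}) (d : 'cV[R]_#|S|)
  : 'cV[R]_n := \col_i \sum_(a < #|S| | enum_val a == i) d a 0.

Definition partial (R : realType) (n : nat) (i : 'I_n) (g : 'cV[R]_n -> R)
  : 'cV[R]_n -> R := fun x => 'D_(delta_mx i 0) g x.

Definition grad (R : realType) (n : nat) (g : 'cV[R]_n -> R) (x : 'cV[R]_n)
  : 'cV[R]_n := \col_i partial i g x.

(* Gradient and Hessian with respect to x_S only: no differentiability in the
   remaining coordinates is involved. *)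
Definition gradS (R : realType) (n : nat) (S : {set 'I_n})
  (g : 'cV[R]_n -> R) (x : 'cV[R]_n) : 'cV[R]_#|S| :=
  \col_a partial (enum_val a) g x.

Definition hessS (R : realType) (n : nat) (S : {set 'I_n})
  (g : 'cV[R]_n -> R) (x : 'cV[R]_n) : 'M[R]_#|S| :=
  \matrix_(a, b) partial (enum_val b) (partial (enum_val a) g) x.

Record C2 (R : realType) (n : nat) (g : 'cV[R]_n -> R) : Prop := {
  C2_diff : forall x, differentiable g x;
  C2_diff_partial : forall i x, differentiable (partial i g) x;
  C2_continuous : forall i j, continuous (partial j (partial i g)) }.

Record problem (R : realType) (n : nat) := Problem {
  f : 'cV[R]_n -> R;
  lam : R;
  r : R -> R }.

(* r'(0^+), possibly +oo *)
Definition dr0 (R : realType) (r : R -> R) : \bar R :=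
  lim ((derive1 r t)%:E @[t --> 0^'+]).

Record problem_ok (R : realType) (n : nat) (P : problem R n) : Prop := {
  lam_gt0 : 0 < lam P;
  f_C2 : C2 (f P);
  r_ge0 : forall t : R, 0 <= r P t;
  r_0 : r P 0 = 0;
  r_derivable : forall t : R, t != 0 -> derivable (r P) t 1;
  r_derivable2 : forall t : R, t != 0 -> derivable (derive1 (r P)) t 1;
  r_continuous2 : forall t : R, t != 0 ->
    {for t, continuous (derive1 (derive1 (r P)) : R -> R)};
  dr_gt0 : forall t : R, 0 < t -> 0 < derive1 (r P) t;
  ddr_le0 : forall t : R, 0 < t -> derive1 (derive1 (r P)) t <= 0;
  dr0_cvg : cvg ((derive1 (r P) t)%:E @[t --> 0^'+]);
  dr0_gt0 : (0 < dr0 (r P))%E }.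

Definition F (R : realType) (n : nat) (P : problem R n) (eps x : 'cV[R]_n)
  : R := f P x + lam P * \sum_i r P (`|x i 0| + eps i 0).

Definition omega (R : realType) (n : nat) (P : problem R n)
  (x eps : 'cV[R]_n) : 'cV[R]_n :=
  \col_i (lam P * derive1 (r P) (`|x i 0| + eps i 0)).

(* subdifferential of t |-> r |t| *)
Definition subdiff_abs (R : realType) (r : R -> R) (t : R) : set R :=
  if t != 0 then [set derive1 r `|t| * Num.sg t]
  else [set v | (- dr0 r <= v%:E <= dr0 r)%E].

Definition stationary (R : realType) (n : nat) (P : problem R n)
  (x : 'cV[R]_n) : Prop :=
  forall i, exists2 v, subdiff_abs (r P) (x i 0) v
                     & partial i (f P) x + lam P * v = 0.

Definition nondegeneracy (R : realType) (n : nat) (P : problem R n) : Prop :=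
  forall x : 'cV[R]_n, stationary P x -> forall i, x i 0 = 0 ->
    (- ((lam P)%:E * dr0 (r P)) < (partial i (f P) x)%:E
       < (lam P)%:E * dr0 (r P))%E.

(* The last two fields are consequences of the first one and [problem_ok]. *)
Record level_set_ok (R : realType) (n : nat) (P : problem R n)
  (x0 eps0 : 'cV[R]_n) : Prop := {
  Lev_bounded : exists rad : R, forall x,
    F P 0 x <= F P eps0 x0 -> norm2 x <= rad;
  F_bounded_below : exists m : R, forall x, m <= F P 0 x;
  grad_Lipschitz : exists2 Lf : R, 0 < Lf & forall x y,
    F P 0 x <= F P eps0 x0 -> F P 0 y <= F P eps0 x0 ->
    norm2 (grad (f P) x - grad (f P) y) <= Lf * norm2 (x - y) }.

Definition Psi (R : realType) (n : nat) (P : problem R n)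
  (x eps : 'cV[R]_n) : 'cV[R]_n :=
  \col_i let g := partial i (f P) x in
         let w := omega P x eps i 0 in
         if (x i 0 == 0) && (g + w < 0) then g + w
         else if (x i 0 == 0) && (0 < g - w) then g - w
         else 0.

Definition Phi (R : realType) (n : nat) (P : problem R n)
  (x eps : 'cV[R]_n) : 'cV[R]_n :=
  \col_i let g := partial i (f P) x in
         let w := omega P x eps i 0 in
         if x i 0 == 0 then 0
         else if (0 < x i 0) && (0 < g + w) then
           Num.min (g + w) (Num.max (x i 0) (g - w))
         else if (x i 0 < 0) && (g - w < 0) then
           Num.max (g - w) (Num.min (x i 0) (g + w))
         else g + w * Num.sg (x i 0).

Definition soft (R : realType) (w v : R) : R :=
  Num.sg v * Num.max (`|v| - w) 0.

Definition orthant_proj (R : realType) (n : nat) (y x : 'cV[R]_n)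
  : 'cV[R]_n :=
  \col_i (Num.sg (x i 0) * Num.max 0 (Num.sg (x i 0) * y i 0)).

Record params (R : realType) := Params {
  eta_Phi : R; eta_Psi : R;
  gamma_eps : R; gamma_beta : R; gamma_alpha : R;
  eta : R; xi_beta : R; xi_alpha : R; beta_bar : R; nu : R;
  tau : R }.

Record params_ok (R : realType) (p : params R) : Prop := {
  eta_Phi_ok : 0 < eta_Phi p <= 1;
  eta_Psi_ok : 0 < eta_Psi p <= 1;
  gamma_eps_ok : 0 < gamma_eps p < 1;
  gamma_beta_ok : 0 < gamma_beta p < 1;
  gamma_alpha_ok : 0 < gamma_alpha p < 1;
  eta_ok : 0 < eta p;
  xi_beta_ok : 0 < xi_beta p;
  xi_alpha_ok : 0 < xi_alpha p;
  beta_bar_ok : 0 < beta_bar p;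
  nu_ok : 0 < nu p;
  tau_ok : 0 <= tau p }.

(* The quantities produced along a run.  At iterations where the QP branch is
   not entered, [qp_mx], [qp_dir], [qp_step] and [qp_pt] are unconstrained by
   the algorithm and do not influence the iterates. *)
Record trace (R : realType) (n : nat) := Trace {
  x : nat -> 'cV[R]_n;
  eps : nat -> 'cV[R]_n;
  zeta : nat -> R;
  W : nat -> {set 'I_n};
  ist_pt : nat -> 'cV[R]_n;                        (* \hat x^k *)
  qp_mx : forall k, 'M[R]_#|W k|;                  (* H^k *)
  qp_dir : forall k, 'cV[R]_#|W k|;                (* \tilde d^k *)
  qp_step : nat -> R;                              (* \tilde\alpha_k *)
  qp_pt : nat -> 'cV[R]_n }.                       (* \tilde x^k *)

Definition stops (R : realType) (n : nat) (P : problem R n) (p : params R)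
  (xk ek : 'cV[R]_n) : Prop :=
  Num.max (norm2 (Psi P xk ek)) (norm2 (Phi P xk ek)) <= tau p /\
  forall i, i \in supp xk -> ek i 0 <= tau p.

Definition subspace_choice (R : realType) (n : nat) (P : problem R n)
  (p : params R) (xk ek : 'cV[R]_n) (Wk : {set 'I_n}) : Prop :=
  let psi := Psi P xk ek in
  let phi := Phi P xk ek in
  if eta p * norm2 phi <= norm2 psi then
    Wk \subset supp psi /\ eta_Psi p * norm2 psi <= norm2 (subv Wk psi)
  else
    Wk \subset supp phi /\ eta_Phi p * norm2 phi <= norm2 (subv Wk phi).

Definition G (R : realType) (n : nat) (P : problem R n)
  (w y : 'cV[R]_n) : R := f P y + \sum_i w i 0 * `|y i 0|.

Definition ist_trial (R : realType) (n : nat) (P : problem R n)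
  (xk w : 'cV[R]_n) (Wk : {set 'I_n}) (beta : R) : 'cV[R]_n :=
  \col_i if i \in Wk
         then soft (beta * w i 0) (xk i 0 - beta * partial i (f P) xk)
         else xk i 0.

Definition ist_step (R : realType) (n : nat) (P : problem R n) (p : params R)
  (xk ek : 'cV[R]_n) (Wk : {set 'I_n}) (xhat : 'cV[R]_n) : Prop :=
  let w := omega P xk ek in
  let y (j : nat) := ist_trial P xk w Wk (beta_bar p * gamma_beta p ^+ j) in
  let accept (j : nat) :=
    G P w (y j) <= G P w xk - xi_beta p / 2 * norm2 (y j - xk) ^+ 2 in
  exists j, [/\ accept j, forall i, (i < j)%N -> ~~ accept i & xhat = y j].

Definition qp_model (R : realType) (m : nat) (g : 'cV[R]_m) (H : 'M[R]_m)
  (d : 'cV[R]_m) : R := dot g d + dot d (H *m d) / 2.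

Definition qp_subproblem (R : realType) (n : nat) (P : problem R n)
  (xk ek : 'cV[R]_n) (Wk : {set 'I_n}) (zetak : R)
  (H : 'M[R]_#|Wk|) (d : 'cV[R]_#|Wk|) : Prop :=
  let g := gradS Wk (F P ek) xk in
  let dR := - (norm2 g ^+ 2 / dot g (H *m g)) *: g in
  [/\ H = hessS Wk (F P ek) xk + zetak%:M, posdef H,
      dot g d <= dot g dR & qp_model g H d <= qp_model g H 0].

(* sup {alpha > 0 : sgn (x + alpha d) = sgn x}, possibly +oo *)
Definition alpha_B (R : realType) (n : nat) (xk d : 'cV[R]_n) : \bar R :=
  ereal_sup [set a%:E | a in [set a : R | 0 < a /\
                                sgnv (xk + a *: d) = sgnv xk]].

(* [ls_state g x d j] is the j-th trial step size, after the possible reset to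
   min {1, alpha_B}, with a flag telling whether the (unique) reset has already
   taken place. *)
Fixpoint ls_state (R : realType) (n : nat) (gam : R) (xk d : 'cV[R]_n)
  (j : nat) : R * bool :=
  let: (a, was_reset) :=
    if j is j'.+1 then
      let: (a', b') := ls_state gam xk d j' in (gam * a', b')
    else (1, false) in
  if ~~ was_reset && (sgnv (orthant_proj (xk + a *: d) xk) == sgnv xk)
  then (fine (Order.min 1%E (alpha_B xk d)), true)
  else (a, was_reset).

Definition line_search (R : realType) (n : nat) (P : problem R n)
  (p : params R) (xk ek d : 'cV[R]_n) (alpha : R) (xt : 'cV[R]_n) : Prop :=
  let a (j : nat) := (ls_state (gamma_alpha p) xk d j).1 in
  let y (j : nat) := orthant_proj (xk + a j *: d) xk in
  let accept (j : nat) :=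
    F P ek (y j) <= F P ek xk - xi_alpha p / 2 * norm2 (y j - xk) ^+ 2 in
  exists j, [/\ accept j, forall i, (i < j)%N -> ~~ accept i,
                alpha = a j & xt = y j].

Definition ist_decrease (R : realType) (n : nat) (P : problem R n)
  (xk ek xhat : 'cV[R]_n) : R :=
  G P (omega P xk ek) xk - G P (omega P xk ek) xhat.

Definition qp_decrease (R : realType) (n : nat) (P : problem R n)
  (xk ek xt : 'cV[R]_n) : R := F P ek xk - F P ek xt.

(* An infinite run of IReNA (the stopping test never succeeds) in which the QP
   subproblem is set up and solved according to the rules of [qp_subproblem]
   only at iterations k < K; later choices of [qp_mx] and [qp_dir] are left
   free, to be prescribed separately. *)
Record IReNA_run (R : realType) (n : nat) (P : problem R n) (p : params R)
  (T : trace R n) (K : nat) : Prop := {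
  run_eps0 : forall i, 0 < eps T 0 i 0;
  run_zeta : forall k, 0 < zeta T k;
  run_continues : forall k, ~ stops P p (x T k) (eps T k);
  run_subspace : forall k, subspace_choice P p (x T k) (eps T k) (W T k);
  run_ist : forall k, ist_step P p (x T k) (eps T k) (W T k) (ist_pt T k);
  run_ist_branch : forall k, sgnv (ist_pt T k) <> sgnv (x T k) ->
    x T k.+1 = ist_pt T k;
  run_qp : forall k, (k < K)%N -> sgnv (ist_pt T k) = sgnv (x T k) ->
    qp_subproblem P (x T k) (eps T k) (zeta T k) (qp_mx T k) (qp_dir T k);
  run_line_search : forall k, sgnv (ist_pt T k) = sgnv (x T k) ->
    line_search P p (x T k) (eps T k) (ext0 (qp_dir T k))
      (qp_step T k) (qp_pt T k);
  run_qp_branch : forall k, sgnv (ist_pt T k) = sgnv (x T k) ->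
    x T k.+1 =
      if (sgnv (qp_pt T k) != sgnv (x T k)) &&
         (qp_decrease P (x T k) (eps T k) (qp_pt T k)
            < nu p * ist_decrease P (x T k) (eps T k) (ist_pt T k))
      then ist_pt T k else qp_pt T k;
  run_eps_supp : forall k i, i \in supp (x T k.+1) ->
    0 < eps T k.+1 i 0 < gamma_eps p * eps T k i 0;
  run_eps_zero : forall k i, i \notin supp (x T k.+1) ->
    eps T k.+1 i 0 = eps T k i 0 }.

(* \chi^\infty *)
Definition stationary_cluster_points (R : realType) (n : nat)
  (P : problem R n) (u : nat -> 'cV[R]_n) : set 'cV[R]_n :=
  [set z | cluster (u @ \oo) z /\ stationary P z].

Definition hess_Lipschitz_near (R : realType) (n : nat) (P : problem R n)
  (xs : 'cV[R]_n) (rho L : R) : Prop :=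
  let B := [set y : 'cV[R]_n | norm2 (y - xs) <= rho /\
                               forall i, xs i 0 = 0 -> y i 0 = 0] in
  forall y z, B y -> B z ->
    opnorm (hessS (supp xs) (F P 0) y - hessS (supp xs) (F P 0) z)
      <= L * norm2 (y - z).

(* The Hessian of F(.; eps) differs from that of F(.; 0) by the diagonal terms
   lam * (r''(|x_i| + eps_i) - r''(|x_i|)).  Lipschitz continuity of the Hessian
   of F(.; 0) alone does not make these O(eps), since a non-Lipschitz r'' may be
   compensated by f: then the second derivative of F(.; 0) is Lipschitz, yet for
   a suitable choice of eps^k one can have |x^{k+1} - x^*| of larger order than
   |x^k - x^*|^2 + |eps^k|. *)
Definition penalty_Lipschitz_near (R : realType) (n : nat) (P : problem R n)
  (xs : 'cV[R]_n) : Prop :=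
  forall i, i \in supp xs -> exists L : R, exists2 delta : R, 0 < delta &
    forall s t : R, `|s - `|xs i 0| | <= delta -> `|t - `|xs i 0| | <= delta ->
      `|derive1 (derive1 (r P)) s - derive1 (derive1 (r P)) t| <= L * `|s - t|.

(* Main.v *)
Require Import Defs.
From HB Require Import structures.
From mathcomp Require Import all_boot all_order all_algebra.
From mathcomp Require Import all_classical all_reals all_analysis.
From mathcomp Require Import ring lra.

Set Implicit Arguments.
Unset Strict Implicit.
Unset Printing Implicit Defensive.

Import Order.TTheory GRing.Theory Num.Theory.
Import numFieldNormedType.Exports.

Local Open Scope classical_set_scope.
Local Open Scope ring_scope.

(** Write S for the support of xs, h = x^k - xs and v = x^k + d^k - xs.  Since
    the gradient of F(.;0) in the S-coordinates vanishes at xs, the Newton step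
    satisfies
      H_eps(x^k) v = [H_0(x^k) h - (g_0(x^k) - g_0(xs))]
                     + (H_eps - H_0)(x^k) h - (g_eps - g_0)(x^k).
    The bracket is at most L_H/2 |h|^2 by Taylor's formula, the other two terms
    are O(|eps_S|) because r' and r'' are Lipschitz near |xs_i|, and for x^k
    near xs and small eps the matrix H_eps(x^k) is a perturbation of H_0(xs), so
    that |v| <= 3M/2 |H_eps(x^k) v|.  In particular v is small, hence x^k + d^k
    has the signs of xs: the orthant projection does not change it, and no
    branch of the algorithm that returns the IST point can be taken. *)

(** * Euclidean inner product and norm *)

Lemma dotC (R : realType) (n : nat) (u v : 'cV[R]_n) : dot u v = dot v u.
Proof. by apply: eq_bigr => i _; rewrite mulrC. Qed.

Lemma dotDl (R : realType) (n : nat) (u v w : 'cV[R]_n) :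
  dot (u + v) w = dot u w + dot v w.
Proof. by rewrite -big_split; apply: eq_bigr => i _; rewrite mxE mulrDl. Qed.

Lemma dotZl (R : realType) (n : nat) (a : R) (u v : 'cV[R]_n) :
  dot (a *: u) v = a * dot u v.
Proof. by rewrite mulr_sumr; apply: eq_bigr => i _; rewrite mxE mulrA. Qed.

Lemma dotDr (R : realType) (n : nat) (u v w : 'cV[R]_n) :
  dot u (v + w) = dot u v + dot u w.
Proof. by rewrite dotC dotDl !(dotC _ u). Qed.

Lemma dotZr (R : realType) (n : nat) (a : R) (u v : 'cV[R]_n) :
  dot u (a *: v) = a * dot u v.
Proof. by rewrite dotC dotZl dotC. Qed.

Lemma dot_ge0 (R : realType) (n : nat) (u : 'cV[R]_n) : 0 <= dot u u.
Proof. by apply: sumr_ge0 => i _; rewrite -expr2 sqr_ge0. Qed.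

Lemma dot_eq0 (R : realType) (n : nat) (u : 'cV[R]_n) : dot u u = 0 -> u = 0.
Proof.
move=> /eqP; rewrite psumr_eq0 => [/allP u0|i _]; last first.
  by rewrite -expr2 sqr_ge0.
apply/matrixP => i j; rewrite ord1 mxE; apply/eqP.
by have := u0 i (mem_index_enum _); rewrite mulf_eq0 orbb.
Qed.

Lemma norm2_ge0 (R : realType) (n : nat) (u : 'cV[R]_n) : 0 <= norm2 u.
Proof. exact: sqrtr_ge0. Qed.

Lemma sqr_norm2 (R : realType) (n : nat) (u : 'cV[R]_n) :
  norm2 u ^+ 2 = dot u u.
Proof. by rewrite sqr_sqrtr ?dot_ge0. Qed.

Lemma norm2_eq0 (R : realType) (n : nat) (u : 'cV[R]_n) :
  norm2 u = 0 -> u = 0.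
Proof. by move=> u0; apply: dot_eq0; rewrite -sqr_norm2 u0 expr0n. Qed.

Lemma norm2_0 (R : realType) (n : nat) : norm2 (0 : 'cV[R]_n) = 0.
Proof. by rewrite /norm2 -(scale0r 0) dotZl mul0r sqrtr0. Qed.

Lemma norm2Z (R : realType) (n : nat) (a : R) (u : 'cV[R]_n) :
  norm2 (a *: u) = `|a| * norm2 u.
Proof.
by rewrite /norm2 dotZl dotZr mulrA -expr2 sqrtrM ?sqr_ge0// sqrtr_sqr.
Qed.

Lemma norm2N (R : realType) (n : nat) (u : 'cV[R]_n) : norm2 (- u) = norm2 u.
Proof. by rewrite -scaleN1r norm2Z normrN1 mul1r. Qed.

Lemma dot_le_norm2 (R : realType) (n : nat) (u v : 'cV[R]_n) :
  dot u v <= norm2 u * norm2 v.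
Proof.
have [u0|u0] := eqVneq (norm2 u) 0.
  rewrite u0 mul0r (norm2_eq0 u0) -(scale0r 0) dotZl mul0r //.
have [v0|v0] := eqVneq (norm2 v) 0.
  rewrite v0 mulr0 (norm2_eq0 v0) -(scale0r 0) dotZr mul0r //.
have uv0 : 0 < norm2 u * norm2 v.
  by rewrite mulr_gt0// lt_neqAle eq_sym ?u0 ?v0 norm2_ge0.
(* With a = |u| and b = |v|, the squared norm of b u - a v is 2ab(ab - u.v); dividing by 2ab > 0
   gives Cauchy-Schwarz. *)
have := dot_ge0 (norm2 v *: u + (- norm2 u) *: v).
rewrite !(dotDl, dotDr, dotZl, dotZr) -!sqr_norm2 (dotC v u) => h.
rewrite -(ler_pM2l uv0); move: h; set a := norm2 u; set b := norm2 v.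
nra.
Qed.

Lemma norm2D (R : realType) (n : nat) (u v : 'cV[R]_n) :
  norm2 (u + v) <= norm2 u + norm2 v.
Proof.
rewrite -(@ler_pXn2r _ 2) ?nnegrE ?norm2_ge0 ?addr_ge0 ?norm2_ge0//.
rewrite sqr_norm2 !(dotDl, dotDr) -!sqr_norm2 (dotC v u).
have := dot_le_norm2 u v; lra.
Qed.

Lemma le_norm2 (R : realType) (m : nat) (c : R) (u w : 'cV[R]_m) :
  0 <= c -> (forall i, `|u i 0| <= c * `|w i 0|) -> norm2 u <= c * norm2 w.
Proof.
move=> c0 uw; rewrite -[c](ger0_norm c0) -norm2Z ler_wsqrtr//.
apply: ler_sum => i _; rewrite -!expr2 -(real_normK (num_real (u i 0))).
rewrite -(real_normK (num_real ((c *: w) i 0))) lerXn2r ?nnegrE//.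
by rewrite mxE normrM (ger0_norm c0).
Qed.

Lemma coord_le_norm2 (R : realType) (n : nat) (u : 'cV[R]_n) (i : 'I_n) :
  `|u i 0| <= norm2 u.
Proof.
rewrite -sqrtr_sqr ler_wsqrtr// /dot (bigD1 i)//= expr2 lerDl.
by apply: sumr_ge0 => j _; rewrite -expr2 sqr_ge0.
Qed.

(** * Operator norm and perturbation of an inverse *)

(** Cauchy-Schwarz on each row gives the Frobenius norm as a bound. It makes the set in [opnorm]
    bounded above, so that its [sup] is a genuine supremum. *)
Lemma norm2_mulmx_bound (R : realType) (m n : nat) (A : 'M[R]_(m, n)) :
  exists2 c, 0 <= c & forall v, norm2 (A *m v) <= c * norm2 v.
Proof.
pose w : 'cV[R]_m := \col_i norm2 (row i A)^T.
exists (norm2 w) => [|v]; first exact: norm2_ge0.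
rewrite mulrC; apply: le_norm2 => [|i]; first exact: norm2_ge0.
rewrite [w i 0]mxE [`|norm2 _|]ger0_norm ?norm2_ge0// mxE [leRHS]mulrC.
have -> : \sum_j A i j * v j 0 = dot (row i A)^T v.
  by apply: eq_bigr => j _; rewrite !mxE.
rewrite ler_norml dot_le_norm2 andbT lerNl -mulN1r -dotZl.
by rewrite (le_trans (dot_le_norm2 _ _))// norm2Z normrN1 mul1r.
Qed.

Lemma norm2_mulmx (R : realType) (m n : nat) (A : 'M[R]_(m, n)) v :
  norm2 (A *m v) <= opnorm A * norm2 v.
Proof.
have [c c0 Ac] := norm2_mulmx_bound A.
have [v0|v0] := eqVneq (norm2 v) 0.
  by have := Ac v; rewrite v0 !mulr0.
have vp : 0 < norm2 v by rewrite lt_neqAle eq_sym v0 norm2_ge0.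
rewrite -ler_pdivrMr// mulrC -[(norm2 v)^-1]ger0_norm ?invr_ge0 ?norm2_ge0//.
rewrite -norm2Z scalemxAr; apply: ub_le_sup.
  exists c => _ [u /= u1 <-]; rewrite (le_trans (Ac u))//.
  by rewrite ler_piMr.
exists ((norm2 v)^-1 *: v) => //=.
by rewrite norm2Z ger0_norm ?invr_ge0 ?norm2_ge0// mulVf.
Qed.

(** From v = A^-1 (B v - (B - A) v) one gets |v| <= M |B v| + |v| / 3. Absorbing the last term on
    the left produces the factor 3/2. *)
Lemma norm2_le_inv_perturbed (R : realType) (m : nat) (A B : 'M[R]_m) (M : R)
    (v : 'cV[R]_m) :
  0 < M -> A \in unitmx -> opnorm (invmx A) <= M ->
  norm2 ((B - A) *m v) <= (3 * M)^-1 * norm2 v ->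
  norm2 v <= 3 * M / 2 * norm2 (B *m v).
Proof.
move=> M0 uA AM BA.
have vE : v = invmx A *m (B *m v - (B - A) *m v).
  by rewrite mulmxBl opprB addrCA subrr addr0 mulKmx.
have h1 : norm2 v <= M * (norm2 (B *m v) + (3 * M)^-1 * norm2 v).
  rewrite {1}vE; apply: le_trans (norm2_mulmx _ _) _.
  apply: le_trans (ler_wpM2r (norm2_ge0 _) AM) _; rewrite ler_pM2l//.
  by rewrite (le_trans (norm2D _ _))// norm2N lerD2l.
have e : M * ((3 * M)^-1 * norm2 v) = norm2 v / 3 by field; rewrite gt_eqF.
move: h1; rewrite mulrDr e; lra.
Qed.

(** * Restriction to a coordinate subset and extension by zero *)

Lemma norm2_subv_supported (R : realType) (n : nat) (S : {set 'I_n})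
    (v : 'cV[R]_n) :
  (forall i, i \notin S -> v i 0 = 0) -> norm2 (subv S v) = norm2 v.
Proof.
move=> v0; congr Num.sqrt; rewrite /dot.
rewrite [RHS](bigID (mem S)) /=.
rewrite [X in _ = _ + X]big1 => [|i /v0 ->]; last by rewrite mul0r.
by rewrite addr0 [RHS]big_enum_val; apply: eq_bigr => a _; rewrite !mxE.
Qed.

Lemma subv_ext0 (R : realType) (n : nat) (S : {set 'I_n}) (d : 'cV[R]_#|S|) :
  subv S (ext0 d) = d.
Proof.
apply/matrixP => a j; rewrite ord1 !mxE (big_pred1 a) // => b /=.
by rewrite (inj_eq enum_val_inj).
Qed.

Lemma ext0_notin (R : realType) (n : nat) (S : {set 'I_n}) (d : 'cV[R]_#|S|) i :
  i \notin S -> ext0 d i 0 = 0.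
Proof.
move=> iS; rewrite mxE big_pred0// => a; apply/negbTE.
by apply: contra iS => /eqP <-; exact: enum_valP.
Qed.

(** * First and second derivatives of the smoothed objective *)

(** Both sides have the same difference quotients. Directional derivatives thereby become
    one-variable ones, to which the usual calculus rules and the mean value theorem apply. *)
Lemma is_derive_line (R : realType) (V : normedModType R) (g : V -> R) (x v : V)
    (t d : R) :
  is_derive t 1 (fun s => g (s *: v + x)) d <->
  is_derive (t *: v + x) v g d.
Proof.
have E : (fun h : R => h^-1 *: ((g \o shift (t *: v + x)) (h *: v)
                               - g (t *: v + x))) =
         (fun h : R => h^-1 *: (((fun s => g (s *: v + x)) \o shift t) (h *: 1)
                               - g (t *: v + x))).
  apply/funext => h /=; congr (_ *: (g _ - _)).
  by rewrite addrA -scalerDl [h%:A]mulr1.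
split=> -[dg Dg]; split.
- by rewrite /derivable E.
- by rewrite /derive E.
- by rewrite /derivable -E.
- by rewrite /derive -E.
Qed.

Lemma is_derive_comp1 (R : realType) (g h : R -> R) (x dg dh : R) :
  is_derive (h x) 1 g dg -> is_derive x 1 h dh ->
  is_derive x 1 (g \o h) (dg * dh).
Proof.
move=> [eg <-] [eh <-]; split; last by rewrite -!derive1E; exact: derive1_comp.
by apply/derivable1_diffP/differentiable_comp; apply/derivable1_diffP.
Qed.

Lemma near_line_neq0 (R : realType) (a b t : R) :
  t * a + b != 0 -> \forall s \near t, Num.sg (s * a + b) = Num.sg (t * a + b).
Proof.
have cl : (fun s => s * a + b) @ t --> t * a + b.
  by apply: cvgD; [apply: cvgM; [exact: cvg_id|exact: cvg_cst]|exact: cvg_cst].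
rewrite neq_lt => /orP[n|p].
  near=> s; rewrite !ltr0_sg//; near: s; exact: (cvgr_lt _ cl).
near=> s; rewrite !gtr0_sg//; near: s; exact: (cvgr_gt _ cl).
Unshelve. all: by end_near. Qed.

(** Near t the affine function keeps its sign, so its absolute value is locally the constant [sg]
    times an affine function, and the chain rule applies. *)
Lemma is_derive_abs_line (R : realType) (g : R -> R) (a b c t : R) :
  t * a + b != 0 -> derivable g (`|t * a + b| + c) 1 ->
  is_derive t 1 (fun s => g (`|s * a + b| + c))
    (derive1 g (`|t * a + b| + c) * Num.sg (t * a + b) * a).
Proof.
move=> n0 dg; set sg := Num.sg (t * a + b).
pose h s := sg * (s * a + b) + c.
have ht : h t = `|t * a + b| + c by rewrite /h /sg normrEsg.
apply: (@near_eq_is_derive _ _ _ (g \o h)).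
  near=> s; rewrite /h /= /sg -(near (near_line_neq0 n0) s)//.
  by rewrite -normrEsg.
rewrite -mulrA -ht; apply: is_derive_comp1.
  by rewrite derive1E; apply: derivableP; rewrite ht.
have -> : h = ((sg * a) \*: id) + cst (sg * b + c).
  by apply/funext => s; rewrite /h fctE /= /GRing.scale/=; ring.
apply: is_derive_eq; last by rewrite addr0 [_%:A]mulr1.
Unshelve. all: by end_near. Qed.

Lemma partial_F (R : realType) (n : nat) (P : problem R n) (e x : 'cV[R]_n)
    (i : 'I_n) :
  problem_ok P -> x i 0 != 0 -> 0 <= e i 0 ->
  partial i (F P e) x =
    partial i (f P) x
    + lam P * (derive1 (r P) (`|x i 0| + e i 0) * Num.sg (x i 0)).
Proof.
move=> hP xi ei; pose v : 'cV[R]_n := delta_mx i 0.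
(* Along the i-th axis only the i-th penalty term varies; the others, whose coordinates may vanish,
   are collected in a constant. *)
pose c := \sum_(j | j != i) r P (`|x j 0| + e j 0).
suff : is_derive (0 : R) 1 (fun s => F P e (s *: v + x))
    (partial i (f P) x
     + lam P * (derive1 (r P) (`|x i 0| + e i 0) * Num.sg (x i 0))).
  by move=> /is_derive_line; rewrite scale0r add0r => /@derive_val.
have -> : (fun s => F P e (s *: v + x)) =
    (fun s => f P (s *: v + x)) +
    (lam P \*: ((fun s => r P (`|s * 1 + x i 0| + e i 0)) + cst c)).
  apply/funext => s; rewrite /F !fctE (bigD1 i)//=; congr (_ + _ * (_ + _)).
    by rewrite !mxE !eqxx.
  by apply: eq_bigr => j ji; rewrite !mxE (negPf ji) mulr0 add0r.
apply: is_deriveD.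
  apply/is_derive_line; rewrite scale0r add0r; apply: derivableP.
  exact/diff_derivable/(C2_diff (f_C2 hP)).
apply: is_deriveZ; rewrite -[X in is_derive _ _ _ X]addr0; apply: is_deriveD.
have E : 0 * 1 + x i 0 = x i 0 by rewrite mul0r add0r.
have := @is_derive_abs_line _ (r P) 1 (x i 0) (e i 0) 0.
rewrite E mulr1; apply=> //; apply: (r_derivable hP).
by rewrite gt_eqF// ltr_pwDl// normr_gt0.
Qed.

(** The formula of [partial_F] requires a nonzero i-th coordinate. This persists for small s, with
    the same sign, so the formula can be differentiated along the line. *)
Lemma is_derive_partial_F (R : realType) (n : nat) (P : problem R n)
    (e x h : 'cV[R]_n) (i : 'I_n) :
  problem_ok P -> x i 0 != 0 -> 0 <= e i 0 ->
  is_derive x h (partial i (F P e))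
    ('D_h (partial i (f P)) x
     + lam P * (derive1 (derive1 (r P)) (`|x i 0| + e i 0) * h i 0)).
Proof.
move=> hP xi ei.
suff : is_derive (0 : R) 1 (fun s => partial i (F P e) (s *: h + x))
    ('D_h (partial i (f P)) x
     + lam P * (derive1 (derive1 (r P)) (`|x i 0| + e i 0) * h i 0)).
  by move=> /is_derive_line; rewrite scale0r add0r.
have E : 0 * h i 0 + x i 0 = x i 0 by rewrite mul0r add0r.
have E0 : 0 * h i 0 + x i 0 != 0 by rewrite E.
have sgx := near_line_neq0 E0; rewrite E in sgx.
apply: (@near_eq_is_derive _ _ _ ((fun s => partial i (f P) (s *: h + x)) +
  (lam P \*: (Num.sg (x i 0) \*:
    (fun s => derive1 (r P) (`|s * h i 0 + x i 0| + e i 0)))))).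
  near=> s.
  have sgs : Num.sg (s * h i 0 + x i 0) = Num.sg (x i 0) by near: s.
  have sxE : (s *: h + x) i 0 = s * h i 0 + x i 0 by rewrite !mxE.
  rewrite partial_F// sxE; last by rewrite -sgr_eq0 sgs sgr_eq0.
  by rewrite sgs !fctE /= [_ *: derive1 _ _]mulrC.
apply: is_deriveD.
  apply/is_derive_line; rewrite scale0r add0r; apply: derivableP.
  exact/diff_derivable/(C2_diff_partial (f_C2 hP)).
apply: is_deriveZ.
have := @is_derive_abs_line _ (derive1 (r P)) (h i 0) (x i 0) (e i 0) 0 E0.
rewrite E => dr; apply: is_derive_eq.
  apply: is_deriveZ; apply: dr; apply: (r_derivable2 hP).
  by rewrite gt_eqF// ltr_pwDl// normr_gt0.
(* One sign comes from the first derivative, the other from differentiating the absolute value; they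
   cancel. *)
have ss : Num.sg (x i 0) ^+ 2 = 1 by rewrite sqr_sg xi.
by rewrite /GRing.scale /= -[RHS]mul1r -ss; ring.
Unshelve. all: by end_near. Qed.

Lemma partial2_F (R : realType) (n : nat) (P : problem R n)
    (e x : 'cV[R]_n) (i j : 'I_n) :
  problem_ok P -> x i 0 != 0 -> 0 <= e i 0 ->
  partial j (partial i (F P e)) x =
    partial j (partial i (f P)) x
    + lam P * (derive1 (derive1 (r P)) (`|x i 0| + e i 0) * (i == j)%:R).
Proof.
move=> hP xi ei.
rewrite /partial (@derive_val _ _ _ _ _ _ _ (is_derive_partial_F _ hP xi ei)).
by rewrite mxE eqxx andbT.
Qed.

Lemma derive_sum_partial (R : realType) (n : nat) (g : 'cV[R]_n -> R)
    (x h : 'cV[R]_n) :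
  differentiable g x -> 'D_h g x = \sum_j partial j g x * h j 0.
Proof.
move=> dg; rewrite deriveE//.
have hE : h = \sum_j h j 0 *: delta_mx j 0.
  rewrite [LHS]matrix_sum_delta; apply: eq_bigr => j _.
  by rewrite big_ord1.
rewrite [in LHS]hE linear_sum; apply: eq_bigr => j _.
by rewrite linearZ /= /partial deriveE// mulrC.
Qed.

(** Since h vanishes off S, the sum over all coordinates in the derivative along h reduces to S and
    becomes a row of the reduced Hessian times h. *)
Lemma is_derive_gradS_line (R : realType) (n : nat) (P : problem R n)
    (e z h : 'cV[R]_n) (S : {set 'I_n}) (t : R) (a : 'I_#|S|) :
  problem_ok P -> (forall i, i \notin S -> h i 0 = 0) ->
  (forall i, i \in S -> (t *: h + z) i 0 != 0) ->
  (forall i, i \in S -> 0 <= e i 0) ->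
  is_derive t 1 (fun s => gradS S (F P e) (s *: h + z) a 0)
    ((hessS S (F P e) (t *: h + z) *m subv S h) a 0).
Proof.
move=> hP h0 zS eS.
have -> : (fun s => gradS S (F P e) (s *: h + z) a 0) =
          (fun s => partial (enum_val a) (F P e) (s *: h + z)).
  by apply/funext => s; rewrite mxE.
apply/is_derive_line; set y := t *: h + z.
have aS := enum_valP a.
apply: is_derive_eq (is_derive_partial_F h hP (zS _ aS) (eS _ aS)) _.
rewrite derive_sum_partial; last exact: (C2_diff_partial (f_C2 hP)).
rewrite (bigID (mem S)) /= [X in _ + X + _]big1 => [|j /h0 ->]; last first.
  by rewrite mulr0.
rewrite addr0 big_enum_val /= [RHS]mxE.
under [RHS]eq_bigr => b _ do rewrite !mxE partial2_F ?zS ?eS// mulrDl.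
rewrite big_split /=; congr (_ + _).
rewrite (bigD1 a)//= eqxx mulr1 [X in _ = _ + X]big1 => [|b ba].
  by rewrite addr0 mulrA.
by rewrite (inj_eq enum_val_inj) eq_sym (negPf ba) !mulr0 mul0r.
Qed.

(** * Taylor estimate for the reduced gradient *)

Lemma dotNr (R : realType) (n : nat) (u v : 'cV[R]_n) :
  dot u (- v) = - dot u v.
Proof. by rewrite -scaleN1r dotZr mulN1r. Qed.

(** Here t - t^2/2 is the antiderivative of 1 - t, matching a Lipschitz bound anchored at the end
    point t = 1. *)
Lemma is_derive_taylor_gap (R : realType) (g : R -> R) (p q c s : R) :
  is_derive s 1 g q ->
  is_derive s 1 (fun t => t * p - g t - c * (t - t ^+ 2 / 2))
    (p - q - c * (1 - s)).
Proof.
move=> dg.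
have -> : (fun t => t * p - g t - c * (t - t ^+ 2 / 2)) =
    ((p \*: id) - g) - c \*: (id - 2^-1 \*: (id ^+ 2)).
  apply/funext => t; rewrite !fctE /GRing.scale /=.
  by congr (_ - _ - _ * (_ - _)); rewrite mulrC.
by apply: is_derive_eq; rewrite /GRing.scale /= expr1; field.
Qed.

(** No mean value equality holds for vector-valued maps, so the residual is paired with itself and
    the scalar theorem is applied. The Hessian sits at the end point h + z, as in a Newton step; the
    weight 1 - t accounts for the factor 1/2. *)
Lemma gradS_taylor (R : realType) (n : nat) (P : problem R n)
    (e z h : 'cV[R]_n) (S : {set 'I_n}) (L : R) :
  problem_ok P -> 0 <= L ->
  (forall i, i \notin S -> h i 0 = 0) ->
  (forall i, i \in S -> 0 <= e i 0) ->
  (forall (t : R) i, 0 <= t <= 1 -> i \in S -> (t *: h + z) i 0 != 0) ->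
  (forall t : R, 0 <= t <= 1 ->
    opnorm (hessS S (F P e) (h + z) - hessS S (F P e) (t *: h + z))
      <= L * ((1 - t) * norm2 h)) ->
  norm2 (hessS S (F P e) (h + z) *m subv S h
         - (gradS S (F P e) (h + z) - gradS S (F P e) z))
    <= L / 2 * norm2 h ^+ 2.
Proof.
move=> hP L0 h0 eS zS HL.
set A := hessS S (F P e) (h + z); set Ah := A *m subv S h.
set u : 'cV[R]_#|S| := (X in norm2 X).
pose g s := gradS S (F P e) (s *: h + z).
pose B s := hessS S (F P e) (s *: h + z) *m subv S h.
pose c := L * norm2 h ^+ 2 * norm2 u.
(* [chi] is nonincreasing, and chi 1 <= chi 0 is |u|^2 <= c / 2. *)
pose chi s := s * dot u Ah - dot u (g s) - c * (s - s ^+ 2 / 2).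
pose dchi s := dot u (Ah - B s) - c * (1 - s).
have dchiE (s : R) : 0 <= s <= 1 -> is_derive s 1 chi (dchi s).
  move=> s01.
  have dg : is_derive s 1 (fun t => dot u (g t)) (dot u (B s)).
    have -> : (fun t => dot u (g t)) =
        \sum_(a < #|S|) (u a 0 \*: (fun t => g t a 0)).
      by apply/funext => t; rewrite fct_sumE.
    apply: is_derive_sum => a; apply: is_deriveZ.
    by apply: is_derive_gradS_line => // i; apply: zS.
  by rewrite /dchi dotDr dotNr; apply: is_derive_taylor_gap.
have dchi_le0 (s : R) : 0 <= s <= 1 -> dchi s <= 0.
  move=> s01; rewrite /dchi subr_le0 /Ah /B -mulmxBl.
  apply: le_trans (dot_le_norm2 _ _) _.
  have le_h : norm2 ((A - hessS S (F P e) (s *: h + z)) *m subv S h)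
      <= L * ((1 - s) * norm2 h) * norm2 h.
    rewrite -[X in _ <= _ * X](norm2_subv_supported h0).
    apply: le_trans (norm2_mulmx _ _) _.
    by apply: ler_wpM2r (HL _ s01); exact: norm2_ge0.
  apply: le_trans (ler_wpM2l (norm2_ge0 u) le_h) _.
  by rewrite le_eqVlt /c; apply/orP; left; apply/eqP; ring.
have [s s01 chiE] : exists2 s,
    s \in `]0, 1[%R & chi 1 - chi 0 = dchi s * (1 - 0).
  apply: MVT => // [s|].
    by rewrite in_itv /= => /andP[/ltW s0 /ltW s1]; apply: dchiE; rewrite s0.
  apply: derivable_within_continuous => s; rewrite in_itv /= => s01.
  by have := dchiE s s01; case.
have : chi 1 - chi 0 <= 0.
  rewrite chiE subr0 mulr1 dchi_le0//.
  by move: s01; rewrite in_itv /= => /andP[/ltW -> /ltW ->].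
have -> : chi 1 - chi 0 = norm2 u ^+ 2 - c / 2.
  have uE : dot u u = dot u Ah - (dot u (g 1) - dot u (g 0)).
    by rewrite {2}/u !(dotDr, dotNr) /g scale1r scale0r add0r.
  have alg (p q1 q0 b : R) :
      1 * p - q1 - b * (1 - 1 ^+ 2 / 2) - (0 * p - q0 - b * (0 - 0 ^+ 2 / 2)) =
      p - (q1 - q0) - b / 2 by field.
  by rewrite sqr_norm2 uE -alg.
rewrite subr_le0 /c => le_u.
(* The inequality |u|^2 <= c / 2 contains |u| on the right as well, and is divided by it when
   nonzero. *)
have [u0|u0] := eqVneq (norm2 u) 0.
  by rewrite u0 mulr_ge0 ?divr_ge0 ?sqr_ge0.
have up : 0 < norm2 u by rewrite lt_neqAle eq_sym u0 norm2_ge0.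
rewrite -(ler_pM2r up) -expr2 (le_trans le_u)// le_eqVlt.
by apply/orP; left; apply/eqP; move: (norm2 u) (norm2 h) => b a; field.
Qed.

(** * Effect of the smoothing parameter on gradient and Hessian *)

(** The contributions of f cancel and the penalty is separable, so the difference of Hessians is
    diagonal. *)
Lemma hessS_F_eps (R : realType) (n : nat) (P : problem R n)
    (e z : 'cV[R]_n) (S : {set 'I_n}) (v : 'cV[R]_#|S|) (a : 'I_#|S|) :
  problem_ok P -> (forall i, i \in S -> z i 0 != 0) ->
  (forall i, i \in S -> 0 <= e i 0) ->
  ((hessS S (F P e) z - hessS S (F P 0) z) *m v) a 0 =
    lam P * (derive1 (derive1 (r P)) (`|z (enum_val a) 0| + e (enum_val a) 0)
             - derive1 (derive1 (r P)) `|z (enum_val a) 0|) * v a 0.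
Proof.
move=> hP zS eS; have aS := enum_valP a.
have entry b : (hessS S (F P e) z - hessS S (F P 0) z) a b =
    lam P * (derive1 (derive1 (r P)) (`|z (enum_val a) 0| + e (enum_val a) 0)
             - derive1 (derive1 (r P)) `|z (enum_val a) 0|) * (a == b)%:R.
  have E2 (g : 'cV[R]_n) : 0 <= g (enum_val a) 0 -> hessS S (F P g) z a b =
      partial (enum_val b) (partial (enum_val a) (f P)) z + lam P *
      derive1 (derive1 (r P)) (`|z (enum_val a) 0| + g (enum_val a) 0) *
      (a == b)%:R.
    move=> ga; rewrite mxE (partial2_F _ hP (zS _ aS) ga) mulrA.
    by rewrite (inj_eq enum_val_inj).
  have z0 : (0 : 'cV[R]_n) (enum_val a) 0 = 0 by rewrite mxE.
  have subE (A B : 'M[R]_#|S|) : (A - B) a b = A a b - B a b by rewrite !mxE.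
  have alg (q l u w k : R) : q + l * u * k - (q + l * w * k) = l * (u - w) * k.
    by ring.
  have E20 := E2 0; rewrite z0 lexx addr0 in E20.
  rewrite -(alg (partial (enum_val b) (partial (enum_val a) (f P)) z)).
  exact: etrans (subE _ _) (congr2 (fun u v => u - v) (E2 e (eS _ aS)) (E20 _)).
rewrite mxE (bigD1 a)//= [X in _ + X]big1 => [|b ba].
  by rewrite addr0 entry eqxx mulr1.
by rewrite entry eq_sym (negPf ba) mulr0 mul0r.
Qed.

Lemma gradS_F_eps (R : realType) (n : nat) (P : problem R n)
    (e z : 'cV[R]_n) (S : {set 'I_n}) (a : 'I_#|S|) :
  problem_ok P -> (forall i, i \in S -> z i 0 != 0) ->
  (forall i, i \in S -> 0 <= e i 0) ->
  (gradS S (F P e) z - gradS S (F P 0) z) a 0 =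
    lam P * (derive1 (r P) (`|z (enum_val a) 0| + e (enum_val a) 0)
             - derive1 (r P) `|z (enum_val a) 0|) * Num.sg (z (enum_val a) 0).
Proof.
move=> hP zS eS; have aS := enum_valP a.
have z0 : (0 : 'cV[R]_n) (enum_val a) 0 = 0 by rewrite mxE.
rewrite mxE [X in _ + X]mxE ![gradS _ _ _ _ _]mxE.
rewrite (partial_F hP (zS _ aS) (eS _ aS)) (partial_F hP (zS _ aS)) z0// addr0.
by rewrite opprD addrACA subrr add0r -mulrBr -mulrBl mulrA.
Qed.

Lemma gradS_stationary (R : realType) (n : nat) (P : problem R n)
    (z : 'cV[R]_n) :
  problem_ok P -> stationary P z -> gradS (supp z) (F P 0) z = 0.
Proof.
move=> hP sz; apply/matrixP => a j; rewrite ord1 !mxE.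
have := enum_valP a; rewrite inE => za.
rewrite partial_F// ?mxE// addr0.
have [v] := sz (enum_val a).
by rewrite /subdiff_abs za => ->.
Qed.

(* A single [c] is both window radius and inverse Lipschitz constant: the
   property then holds for all small [c], so finitely many [i] can share one. *)
Definition penalty_window (R : realType) (n : nat) (P : problem R n)
    (z : 'cV[R]_n) (c : R) (i : 'I_n) : Prop :=
  i \in supp z -> c < `|z i 0| /\
  forall s t : R, `|s - `|z i 0| | <= c -> `|t - `|z i 0| | <= c ->
    `|derive1 (r P) s - derive1 (r P) t| <= c^-1 * `|s - t| /\
    `|derive1 (derive1 (r P)) s - derive1 (derive1 (r P)) t| <= c^-1 * `|s - t|.

(** A Lipschitz r'' is bounded on the window, and the mean value theorem then makes r' Lipschitz.
    Shrinking c only weakens both bounds. *)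
Lemma penalty_window_near (R : realType) (n : nat) (P : problem R n)
    (z : 'cV[R]_n) :
  problem_ok P -> penalty_Lipschitz_near P z ->
  \forall c \near (0 : R)^'+, forall i, penalty_window P z c i.
Proof.
move=> hP hpen; apply: filter_forall => i.
have [iz|iz] := boolP (i \in supp z); last first.
  by near=> c; rewrite /penalty_window (negPf iz).
have [L [d d0 Ld]] := hpen i iz.
have zi0 : 0 < `|z i 0| by rewrite normr_gt0; move: iz; rewrite inE.
set r1 := derive1 (r P) in Ld *; set r2 := derive1 r1 in Ld *.
(* [b] bounds r'' on the window and [C] dominates both Lipschitz constants; [L] may be negative,
   hence the absolute values. *)
pose b := `|r2 `|z i 0| | + `|L| * d.
have b0 : 0 <= b by rewrite addr_ge0// mulr_ge0// ltW.
pose C := b + `|L| + 1.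
have C0 : 0 < C by rewrite ltr_wpDl// addr_ge0.
near=> c => _.
have c0 : 0 < c by near: c; exact: nbhs_right_gt.
have cd : c <= d by near: c; exact: nbhs_right_le.
have cz : c < `|z i 0| by near: c; exact: nbhs_right_lt.
have Cc : C <= c^-1.
  rewrite -[C]invrK lef_pV2 ?posrE ?invr_gt0//.
  by near: c; apply: nbhs_right_le; rewrite invr_gt0.
split=> // s t sc tc.
have r2_le w : `|w - `|z i 0| | <= c -> `|r2 w| <= b.
  move=> wc; have wd := le_trans wc cd.
  have := Ld w `|z i 0| wd; rewrite subrr normr0 => /(_ (ltW d0)) h.
  rewrite -[r2 w](subrK (r2 `|z i 0|)) (le_trans (ler_normD _ _))//.
  rewrite addrC lerD2l.
  rewrite (le_trans h)// (le_trans (ler_wpM2r _ (ler_norm L)))//.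
  by rewrite ler_wpM2l.
split; last first.
  rewrite (le_trans (Ld _ _ (le_trans sc cd) (le_trans tc cd)))// ler_wpM2r//.
  rewrite (le_trans _ Cc)// (le_trans (ler_norm L))// /C -addrA addrCA lerDl.
  by rewrite addr_ge0.
wlog st : s t sc tc / t <= s.
  move=> H; case/orP: (le_total t s) => ts; first exact: H.
  by rewrite distrC [X in _ * X]distrC; exact: H.
have inw w : w \in `[t, s] -> `|w - `|z i 0| | <= c.
  rewrite in_itv /= => /andP[tw ws]; move: sc tc; rewrite !ler_norml.
  move=> /andP[_ sc2] /andP[tc1 _].
  by rewrite (le_trans tc1) ?(le_trans _ sc2)// lerD2r.
have dr1 w : w \in `[t, s] -> is_derive w 1 r1 (r2 w).
  move=> /inw wc; rewrite /r2 derive1E; apply: derivableP.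
  (* The window excludes 0, where r need not be differentiable, because c < |z_i|. *)
  apply: (r_derivable2 hP); apply: contraTneq wc => ->.
  by rewrite sub0r normrN normr_id -ltNge.
have r1C : {within `[t, s], continuous r1}.
  by apply: derivable_within_continuous => w /dr1 [].
have r1D w : w \in `]t, s[ -> is_derive w 1 r1 (r2 w).
  by move=> wts; apply: dr1; apply: subset_itv_oo_cc wts.
have mvt := @MVT_segment R r1 r2 t s st r1D r1C.
case: mvt => w ws ->.
rewrite normrM ler_wpM2r// (le_trans (r2_le _ (inw _ ws)))// (le_trans _ Cc)//.
by rewrite /C -addrA lerDl addr_ge0.
Unshelve. all: by end_near. Qed.

(** * Error of one Newton step *)

Lemma newton_residual (R : realType) (m : nat) (A B : 'M[R]_m)
    (h g g0 : 'cV[R]_m) :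
  A \in unitmx ->
  A *m (h + - (invmx A *m g)) = (B *m h - g0) + ((A - B) *m h - (g - g0)).
Proof.
move=> uA; rewrite mulmxDr mulmxN mulKVmx// mulmxBl.
by apply/matrixP => a j; rewrite !mxE; ring.
Qed.

(** [S] is a variable equal to [supp z] because the direction has the dependent type indexed by
    [W T k]. The bound 2 rho <= c keeps |y_i| + e_i in the penalty window, rho <= 1 absorbs a factor
    |h_i|, and the bound by 1/(3M) controls the Hessian perturbation. *)
Lemma newton_step_error (R : realType) (n : nat) (P : problem R n)
    (z y e : 'cV[R]_n) (M LH rho0 c rho : R)
    (S : {set 'I_n}) (d : 'cV[R]_#|S|) :
  let He := hessS S (F P e) y in
  S = supp z -> problem_ok P -> 0 < M -> 0 < LH ->
  hessS (supp z) (F P 0) z \in unitmx ->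
  opnorm (invmx (hessS (supp z) (F P 0) z)) <= M ->
  hess_Lipschitz_near P z rho0 LH ->
  stationary P z ->
  0 < c -> (forall i, penalty_window P z c i) ->
  0 < rho -> rho <= rho0 -> rho <= 1 -> 2 * rho <= c ->
  (LH + lam P / c) * rho <= (3 * M)^-1 ->
  (forall i, i \notin S -> y i 0 = 0) ->
  (forall i, i \in S -> 0 <= e i 0) ->
  norm2 (y - z) <= rho -> norm2 (subv S e) <= rho ->
  He \in unitmx -> d = - (invmx He *m gradS S (F P e) y) ->
  norm2 (y + ext0 d - z) <=
    3 * M * LH / 2 * norm2 (y - z) ^+ 2
    + 3 * M * (lam P / c) * norm2 (subv S e).
Proof.
move=> He SE; subst S; set S := supp z in d He *.
move=> hP M0 LH0 uH HM hLip sz c0 pw rho_gt0 rho_rho0 rho1 rhoc rhoM.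
move=> yS eS y_rho e_rho uHe dE.
have l0 := lam_gt0 hP.
set h := y - z in y_rho *; set lc := lam P / c.
have lc0 : 0 <= lc by rewrite divr_ge0// ltW.
have zS i : i \notin S -> z i 0 = 0 by rewrite inE negbK => /eqP.
have hS i : i \notin S -> h i 0 = 0.
  by move=> iS; rewrite !mxE yS// zS// subrr.
have hi i : `|h i 0| <= rho by rewrite (le_trans (coord_le_norm2 _ _)).
have ei i : i \in S -> `|e i 0| <= rho.
  move=> iS; apply: le_trans e_rho.
  have := coord_le_norm2 (subv S e) (enum_rank_in iS i).
  by rewrite mxE enum_rankK_in.
have rho_c : rho <= c by lra.
(* A zero on the segment would give |z_i| = t |h_i| <= rho <= c, against c < |z_i|. *)
have seg (t : R) i : 0 <= t <= 1 -> i \in S -> (t *: h + z) i 0 != 0.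
  move=> /andP[t0 t1] iS; have [cz _] := pw i iS.
  rewrite mxE [(t *: h) i 0]mxE; apply: contraTneq cz => /eqP.
  rewrite addrC addr_eq0 -leNgt => /eqP ->.
  rewrite normrN normrM (ger0_norm t0) (le_trans _ rho_c)//.
  by rewrite (le_trans _ (hi i))// ler_piMl.
have yE : h + z = y by rewrite subrK.
have yS0 i : i \in S -> y i 0 != 0.
  by move=> iS; have := @seg 1 i; rewrite scale1r yE ler01 lexx; exact.
have win i : i \in S ->
    `| `|y i 0| + e i 0 - `|z i 0| | <= c /\ `| `|y i 0| - `|z i 0| | <= c.
  move=> iS; have yz : `| `|y i 0| - `|z i 0| | <= rho.
    rewrite (le_trans (ler_dist_dist _ _))//.
    by have := hi i; rewrite !mxE.
  split; last exact: le_trans yz _.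
  rewrite addrAC (le_trans (ler_normD _ _))//.
  by have := ei i iS; lra.
pose H0 := hessS S (F P 0) y.
have ballz : norm2 (z - z) <= rho0 /\ (forall i, z i 0 = 0 -> z i 0 = 0).
  by rewrite subrr norm2_0 (le_trans (ltW rho_gt0)).
have ballt (t : R) : 0 <= t <= 1 -> norm2 (t *: h + z - z) <= rho0 /\
    (forall i, z i 0 = 0 -> (t *: h + z) i 0 = 0).
  move=> /andP[t0 t1]; split.
    rewrite addrK norm2Z (ger0_norm t0) (le_trans _ rho_rho0)//.
    by rewrite (le_trans _ y_rho)// ler_piMl// norm2_ge0.
  move=> i zi; rewrite mxE [(t *: h) i 0]mxE zi addr0 hS ?mulr0//.
  by rewrite inE zi eqxx.
have bally : norm2 (y - z) <= rho0 /\ (forall i, z i 0 = 0 -> y i 0 = 0).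
  by have := @ballt 1; rewrite scale1r yE ler01 lexx; exact.
have dHv (v : 'cV[R]_#|S|) a :
    `|((He - H0) *m v) a 0| <= lc * `|e (enum_val a) 0| * `|v a 0|.
  have aS := enum_valP a; have [w1 w2] := win _ aS.
  rewrite hessS_F_eps// !normrM (gtr0_norm l0) ler_wpM2r// /lc -!mulrA.
  rewrite ler_pM2l//; have [_ pwa] := pw _ aS.
  by have [_ h2] := pwa _ _ w1 w2; rewrite (le_trans h2)// addrAC subrr add0r.
set v := subv S (y + ext0 d - z).
have vE : norm2 v = norm2 (y + ext0 d - z).
  apply: norm2_subv_supported => i iS.
  by rewrite mxE [(y + _) i 0]mxE [(- z) i 0]mxE yS// zS//
    ext0_notin// subr0 addr0.
have vE2 : v = subv S h + d.
  rewrite -[d in RHS]subv_ext0; apply/matrixP => a j.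
  by rewrite ord1 !mxE addrAC.
pose gd := gradS S (F P e) y - gradS S (F P 0) y.
have HvE : He *m v = (H0 *m subv S h - gradS S (F P 0) y) +
    ((He - H0) *m subv S h - gd).
  by rewrite vE2 dE; exact: newton_residual.
have tay : norm2 (H0 *m subv S h - gradS S (F P 0) y) <= LH / 2 * norm2 h ^+ 2.
  have := @gradS_taylor _ _ P 0 z h S LH hP (ltW LH0) hS.
  rewrite yE gradS_stationary// subr0; apply=> // [i _|t t01].
    by rewrite mxE.
  apply: le_trans (hLip _ _ bally (ballt _ t01)) _.
  rewrite ler_pM2l// -{1}yE opprD addrACA subrr addr0.
  rewrite -{1}[h]scale1r -scalerBl norm2Z ger0_norm//.
  by rewrite subr_ge0; case/andP: t01.
have e1 : norm2 ((He - H0) *m subv S h) <= lc * norm2 (subv S e).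
  apply: le_norm2 => // a; rewrite (le_trans (dHv _ _))//.
  rewrite [subv S e a 0]mxE [subv S h a 0]mxE.
  by apply: ler_piMr; [exact: mulr_ge0|exact: le_trans (hi _) rho1].
have e2 : norm2 gd <= lc * norm2 (subv S e).
  apply: le_norm2 => // a; have aS := enum_valP a; have [w1 w2] := win _ aS.
  rewrite gradS_F_eps// !normrM (gtr0_norm l0) normr_sg yS0// mulr1.
  rewrite /lc -!mulrA ler_pM2l// [subv _ _ _ _]mxE.
  have [_ pwa] := pw _ aS.
  by have [h1 _] := pwa _ _ w1 w2; rewrite (le_trans h1)// addrAC subrr add0r.
(* The Hessian is compared through H_0(y): moving from z to y costs LH rho, and smoothing costs (lam
   / c) rho. *)
have pert : norm2 ((He - hessS S (F P 0) z) *m v) <= (3 * M)^-1 * norm2 v.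
  apply: le_trans (ler_wpM2r (norm2_ge0 v) rhoM).
  have splitE (A B C : 'M[R]_#|S|) : A - C = (B - C) + (A - B).
    by rewrite [RHS]addrC subrKA.
  rewrite (splitE He H0).
  rewrite mulmxDl (le_trans (norm2D _ _))// mulrDl mulrDl lerD//.
    apply: le_trans (norm2_mulmx _ _) _; rewrite ler_wpM2r ?norm2_ge0//.
    apply: le_trans (hLip _ _ bally ballz) _.
    by rewrite ler_pM2l.
  apply: le_norm2 => [|a]; first by apply: mulr_ge0 => //; exact: ltW.
  rewrite (le_trans (dHv _ _))// ler_wpM2r// ler_wpM2l// ei//.
  exact: enum_valP.
rewrite -vE (le_trans (norm2_le_inv_perturbed M0 uH HM pert))//.
have Hv : norm2 (He *m v) <=
    LH / 2 * norm2 h ^+ 2 + (2 * lc) * norm2 (subv S e).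
  rewrite HvE (le_trans (norm2D _ _))// lerD//.
  rewrite (le_trans (norm2D _ _))// norm2N -mulrA; lra.
apply: le_trans (ler_wpM2l _ Hv) _.
  by rewrite divr_ge0// mulr_ge0// ltW.
have q0 : 0 <= M * LH / 2 * norm2 h ^+ 2.
  by rewrite mulr_ge0 ?sqr_ge0// divr_ge0// mulr_ge0// ltW.
(* The quadratic coefficient obtained is 3 M LH / 4; nonnegativity of [q0] relaxes it to 3 M LH /
   2. *)
have fin (q w b : R) : 0 <= M * LH / 2 * q ->
    3 * M / 2 * (LH / 2 * q + 2 * b * w) <= 3 * M * LH / 2 * q + 3 * M * b * w.
  by clear; lra.
exact: fin.
Qed.

(** * Sign identification and decay of the smoothing parameter *)

Lemma orthant_proj_id (R : realType) (n : nat) (y z : 'cV[R]_n) :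
  sgnv y = sgnv z -> orthant_proj y z = y.
Proof.
move=> /matrixP yz; apply/matrixP => i j; rewrite ord1 mxE.
have := yz i 0; rewrite !mxE => <-.
rewrite -normrEsg; have /max_idPr -> := normr_ge0 (y i 0).
by rewrite -numEsg.
Qed.

(** Convergence fixes the signs of the nonzero coordinates of z; at the zero ones equality of
    supports forces the iterate to vanish. *)
Lemma sgnv_near (R : realType) (n : nat) (u : nat -> 'cV[R]_n) (z : 'cV[R]_n)
    (K : nat) :
  u @ \oo --> z -> (forall k, (K <= k)%N -> supp (u k) = supp z) ->
  \forall k \near \oo, sgnv (u k) = sgnv z.
Proof.
move=> uz uS.
have : \forall k \near \oo, forall i, Num.sg (u k i 0) = Num.sg (z i 0).
  apply: filter_forall => i.
  have ui : (fun k => u k i 0) @ \oo --> z i 0.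
    exact: (cvg_comp _ _ uz (@coord_continuous _ _ _ i 0 z)).
  have [zi|zi|zi] := ltrgtP (z i 0) 0.
  - near=> k; rewrite !ltr0_sg//; near: k; exact: (cvgr_lt _ ui).
  - near=> k; rewrite !gtr0_sg//; near: k; exact: (cvgr_gt _ ui).
  - near=> k; have /setP/(_ i) : supp (u k) = supp z.
      by apply: uS; near: k; exact: nbhs_infty_ge.
    by rewrite !inE zi eqxx /= => /negbFE/eqP ->.
by apply: filterS => k uk; apply/matrixP => i j; rewrite ord1 !mxE.
Unshelve. all: by end_near. Qed.

Lemma norm2_geometric_decay (R : realType) (m : nat) (u : nat -> 'cV[R]_m)
    (K : nat) (gam rho : R) :
  0 < gam < 1 -> 0 < rho ->
  (forall k i, (K <= k)%N -> `|u k.+1 i 0| <= gam * `|u k i 0|) ->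
  \forall k \near \oo, norm2 (u k) <= rho.
Proof.
move=> /andP[g0 g1] rho0 ug.
have uK k : norm2 (u (k + K)%N) <= gam ^+ k * norm2 (u K).
  apply: le_norm2 => [|i]; first by rewrite exprn_ge0// ltW.
  elim: k => [|k IH]; first by rewrite expr0 mul1r.
  rewrite addSn (le_trans (ug _ _ (leq_addl _ _)))// exprS -mulrA.
  by rewrite ler_pM2l.
have : (fun k => gam ^+ k * norm2 (u K)) @ \oo --> 0 * norm2 (u K).
  by apply: cvgM; [apply: cvg_expr; rewrite gtr0_norm|exact: cvg_cst].
rewrite mul0r => /cvgr_le /(_ _ rho0) [N _ HN].
exists (N + K)%N => // k /= Nk.
have kE : k = (k - K + K)%N by rewrite subnK// (leq_trans _ Nk)// leq_addl.
rewrite kE (le_trans (uK _))//; apply: HN => /=.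
by rewrite leq_subRL 1?addnC// (leq_trans _ Nk)// leq_addl.
Qed.

Lemma sgr_close (R : realType) (a b : R) :
  `|a - b| < `|b| -> Num.sg a = Num.sg b.
Proof.
have [b0|b0|->] := ltrgtP b 0; last by rewrite normr0 ltNge normr_ge0.
  rewrite (ltr0_norm b0) ltr_norml => /andP[_ ab].
  by rewrite !ltr0_sg//; lra.
rewrite (gtr0_norm b0) ltr_norml => /andP[ab _].
by rewrite !gtr0_sg//; lra.
Qed.

(** The first IST branch would change the signs, against the third hypothesis. In the QP branch the
    projection fixes the full step, and since its signs agree with those of x^k the fallback to the
    IST point is ruled out. *)
Lemma IReNA_next_eq_qp_pt (R : realType) (n : nat) (P : problem R n)
    (p : params R) (T : trace R n) (K k : nat) :
  IReNA_run P p T K -> qp_step T k = 1 ->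
  sgnv (x T k.+1) = sgnv (x T k) ->
  sgnv (x T k + ext0 (qp_dir T k)) = sgnv (x T k) ->
  x T k.+1 = x T k + ext0 (qp_dir T k).
Proof.
move=> run step1 sx sy.
have [ist|/eqP ist] := eqVneq (sgnv (ist_pt T k)) (sgnv (x T k)); last first.
  by have nextE := run_ist_branch run ist; case: ist; rewrite -nextE.
have [j [_ _ aE xt]] := run_line_search run ist.
have qpE : qp_pt T k = x T k + ext0 (qp_dir T k).
  by rewrite xt -aE step1 scale1r orthant_proj_id.
by rewrite (run_qp_branch run ist) qpE sy eqxx.
Qed.

Theorem theorem4 (R : realType) (n : nat) (P : problem R n) (p : params R)
  (T : trace R n) (xs : 'cV[R]_n) (K : nat) (M LH rho0 : R)
  (hP : problem_ok P)
  (hp : params_ok p)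
  (htau : tau p = 0)
  (hlev : level_set_ok P (x T 0) (eps T 0))
  (hnd : nondegeneracy P)
  (hrun : IReNA_run P p T K)
  (hcvg : x T @ \oo --> xs)
  (hxs : stationary_cluster_points P (x T) xs)
  (hM : 0 < M)
  (hunit : hessS (supp xs) (F P 0) xs \in unitmx)
  (hinv : opnorm (invmx (hessS (supp xs) (F P 0) xs)) <= M)
  (hW : forall k, (K <= k)%N -> W T k = supp (x T k) /\ supp (x T k) = supp xs)
  (hH : forall k, (K <= k)%N ->
    qp_mx T k = hessS (W T k) (F P (eps T k)) (x T k))
  (hd : forall k, (K <= k)%N ->
    qp_mx T k \in unitmx /\
    qp_dir T k = - (invmx (qp_mx T k) *m gradS (W T k) (F P (eps T k)) (x T k)))
  (hstep : forall k, (K <= k)%N -> qp_step T k = 1)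
  (hLH : 0 < LH)
  (hrho0 : 0 < rho0)
  (hLip : hess_Lipschitz_near P xs rho0 LH)
  (hpen : penalty_Lipschitz_near P xs) :
  exists (kc : nat) (rho C : R),
    [/\ 0 < rho, rho <= rho0, 0 <= C &
      forall k, (kc <= k)%N -> norm2 (x T k - xs) <= rho ->
        norm2 (x T k.+1 - xs) <=
          3 * M * LH / 2 * norm2 (x T k - xs) ^+ 2
          + C * norm2 (subv (supp xs) (eps T k))].
Proof.
set S := supp xs in hunit hinv *.
have [c c0 pw] : exists2 c, 0 < c & forall i, penalty_window P xs c i.
  near (0 : R)^'+ => c; exists c.
    by near: c; exact: nbhs_right_gt.
  by near: c; exact: penalty_window_near.
have l0 := lam_gt0 hP; pose lc := lam P / c.
have lc0 : 0 < lc by rewrite divr_gt0.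
(* [C] depends only on M, lam and c, so the O-term is uniform in k. *)
pose C := 3 * M * lc; pose A := 3 * M * LH / 2.
have C0 : 0 < C by apply: mulr_gt0 => //; exact: mulr_gt0.
have A0 : 0 < A by rewrite divr_gt0// !mulr_gt0.
have small a b : 0 < a -> 0 < b -> \forall u \near (0 : R)^'+, a * u <= b.
  move=> a0 b0; near=> u; rewrite -ler_pdivlMl//.
  by near: u; apply: nbhs_right_le; rewrite mulr_gt0// invr_gt0.
(* The first four bounds feed [newton_step_error]; the last keeps the Newton point within c of xs,
   which preserves signs on S. *)
have [rho rho_gt0 [rho_rho0 rho1 rhoc rhoM rhoAC]] : exists2 rho : R, 0 < rho &
    [/\ rho <= rho0, rho <= 1, 2 * rho <= c, (LH + lc) * rho <= (3 * M)^-1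
      & (A + C) * rho <= c].
  near (0 : R)^'+ => rho; exists rho.
    by near: rho; exact: nbhs_right_gt.
  split.
  - by near: rho; exact: nbhs_right_le.
  - by near: rho; exact: nbhs_right_le.
  - by near: rho; exact: small.
  - by near: rho; apply: small; [exact: addr_gt0|rewrite invr_gt0 mulr_gt0].
  - by near: rho; apply: small => //; exact: addr_gt0.
have suppS k : (K <= k)%N -> supp (x T k) = S by move=> /hW[].
have epsS k i : (K <= k)%N -> i \in S ->
    0 < eps T k.+1 i 0 < gamma_eps p * eps T k i 0.
  by move=> Kk iS; apply: (run_eps_supp hrun); rewrite suppS// leqW.
have eps_near : \forall k \near \oo, norm2 (subv S (eps T k)) <= rho.
  apply: (norm2_geometric_decay (K := K) (gamma_eps_ok hp)) => // k a Kk.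
  have /andP[e0 e1] := epsS k _ Kk (enum_valP a).
  rewrite !mxE (gtr0_norm e0) (le_trans (ltW e1))// ler_wpM2l ?ler_norm//.
  by have /andP[/ltW] := gamma_eps_ok hp.
have [N _ sgN] := sgnv_near hcvg suppS.
have [N' _ epsN] := eps_near.
(* [K.+1] rather than [K]: positivity of eps^k on S is read off the update from k - 1 to k, which
   needs k - 1 >= K. *)
exists (maxn (maxn N N') K.+1), rho, C; split=> // [|k]; first exact: ltW.
rewrite !geq_max => /andP[/andP[Nk N'k] Kk] xk_rho.
have sgk : sgnv (x T k) = sgnv xs by apply: sgN.
have sgk1 : sgnv (x T k.+1) = sgnv xs by apply: sgN; exact: leqW.
have epsk : norm2 (subv S (eps T k)) <= rho by apply: epsN.
have Kk' := ltnW Kk.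
have WS : W T k = S by have [-> ->] := hW _ Kk'.
have [uH dE] := hd _ Kk'; rewrite hH// in uH dE.
set y := x T k + ext0 (qp_dir T k).
have err : norm2 (y - xs) <=
    A * norm2 (x T k - xs) ^+ 2 + C * norm2 (subv S (eps T k)).
  rewrite -WS.
  apply: (newton_step_error WS hP hM hLH hunit hinv hLip hxs.2 c0 pw rho_gt0)
    => //.
  - move=> i; rewrite WS -(suppS _ Kk') inE negbK => /eqP //.
  - move=> i; rewrite WS => iS.
    case: k Kk {Nk N'k Kk' xk_rho sgk sgk1 epsk WS uH dE y} => // k.
    by rewrite ltnS => Kk; have /andP[/ltW] := epsS k i Kk iS.
  - by rewrite WS.
have err_c : norm2 (y - xs) <= c.
  apply: le_trans err (le_trans _ rhoAC); rewrite mulrDl lerD//.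
    rewrite ler_pM2l// expr2 (le_trans (ler_piMl _ _) xk_rho)// ?norm2_ge0//.
    exact: le_trans rho1.
  by rewrite ler_pM2l.
(* On S the error is at most c < |xs_i|; off S the direction vanishes, leaving the sign of x^k. *)
have sgy : sgnv y = sgnv xs.
  apply/matrixP => i j; rewrite ord1 ![sgnv _ _ _]mxE.
  have [iS|iS] := boolP (i \in S).
    apply: sgr_close; have [cxs _] := pw i iS; apply: le_lt_trans cxs.
    by apply: le_trans err_c; have := coord_le_norm2 (y - xs) i; rewrite !mxE.
  rewrite mxE ext0_notin ?WS// addr0.
  by have /matrixP/(_ i 0) := sgk; rewrite !mxE.
rewrite (IReNA_next_eq_qp_pt hrun (hstep _ Kk'))//; first by rewrite sgk1.
by rewrite -/y sgy.
Unshelve. all: by end_near. Qed.
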